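(* Let $n\in\mathbb N$ and let $\delta$ be a positive infinitesimal. Suppose that $D$ is a directed set and that $d\in D\mapsto[f^d]$ is a $D$-net in $\mathcal G^0_0$ that is $\tau^\delta$-convergent to $[g]\in\mathcal G_0$. Then $[g]\in\mathcal G_0^0$.
   Context: Work in a sufficiently saturated nonstandard extension ${}^*$ of a superstructure over $\mathbb R$. $B_\delta=\{\xi\in{}^*\mathbb R^n:|\xi|\le\delta\}$. $\mathcal G_0$ is the ring of germs at $0\in\mathbb R^n$ of (arbitrary) functions $f:(\mathbb R^n,0)\to(\mathbb R,0)$; $\mathcal G_0^0\subset\mathcal G_0$ is the subring of germs having a representative continuous on some neighborhood of $0$. For a germ $[f]$ put $\|{}^*f\|_\delta={}^*\sup\{|{}^*f(\xi)|:\xi\in B_\delta\}$ (independent of representative, as $B_\delta$ lies in the monad of $0$). $\mathcal N_\delta=\{\|{}^*g\|_\delta:[g]\in\mathcal G_0\}$. For $\mathfrak r\in\mathcal N_\delta$ with $\mathfrak r>0$ let $U^\delta_{\mathfrak r}=\{[f]\in\mathcal G_0:\|{}^*f\|_\delta<\mathfrak r\}$. $\tau^\delta$ is the topology on $\mathcal G_0$ generated by all translates $[f]+U^\delta_{\mathfrak r}$. A net $([f^d])$ is $\tau^\delta$-convergent to $[g]$ if for each such $\mathfrak r$ there is $d_0\in D$ with $\|{}^*f^d-{}^*g\|_\delta<\mathfrak r$ for all $d>d_0$. *)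

(* Defs.v *)
From HB Require Import structures.
From mathcomp Require Import all_boot all_order all_algebra.
From mathcomp Require Import all_classical all_reals all_analysis.

Set Implicit Arguments.
Unset Strict Implicit.
Unset Printing Implicit Defensive.

Import Order.TTheory GRing.Theory Num.Theory.
Import numFieldNormedType.Exports.

Local Open Scope classical_set_scope.
Local Open Scope ring_scope.

(* The superstructure over a set [X] of individuals is presented by types:
   [obj X t] is the collection of all its objects of type [t].  Ordered pairs
   and n-tuples are kept as such instead of being coded by sets, and [Pow] is
   the full power set.  A function is identified with its graph, an object of
   type [Pow (Prod a b)]. *)

Inductive stype : Type :=
| Ind : stype
| Prod : stype -> stype -> stype
| Vec : nat -> stype -> stype
| Pow : stype -> stype.

Fixpoint obj (X : Type) (t : stype) : Type :=
  match t with
  | Ind => X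
  | Prod a b => (obj X a * obj X b)%type
  | Vec n a => 'rV[obj X a]_n
  | Pow a => set (obj X a)
  end.

(* [var G t] is the type of de Bruijn indices of type [t] in the context [G].
   All quantifiers are bounded by a set of the superstructure. *)

Inductive var : seq stype -> stype -> Type :=
| VZ : forall G t, var (t :: G) t
| VS : forall G s t, var G t -> var (s :: G) t.

Inductive form : seq stype -> Type :=
| FEq : forall G t, var G t -> var G t -> form G
| FIn : forall G t, var G t -> var G (Pow t) -> form G
| FPair : forall G a b, var G a -> var G b -> var G (Prod a b) -> form G
| FEntry : forall G n a, 'I_n -> var G (Vec n a) -> var G a -> form G
| FNot : forall G, form G -> form G
| FAnd : forall G, form G -> form G -> form G
| FImp : forall G, form G -> form G -> form G
| FAll : forall G t, var G (Pow t) -> form (t :: G) -> form G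
| FEx : forall G t, var G (Pow t) -> form (t :: G) -> form G.

Fixpoint env (X : Type) (G : seq stype) : Type :=
  if G is t :: G' then (obj X t * env X G')%type else unit.

Fixpoint lookup (X : Type) (G : seq stype) (t : stype) (v : var G t) :
    env X G -> obj X t :=
  match v in var G t return env X G -> obj X t with
  | VZ _ _ => fun e => e.1
  | VS _ _ _ v' => fun e => lookup v' e.2
  end.

Fixpoint sat (X : Type) (G : seq stype) (p : form G) : env X G -> Prop :=
  match p in form G return env X G -> Prop with
  | FEq _ _ x y => fun e => lookup x e = lookup y e
  | FIn _ _ x A => fun e => (lookup A e : set _) (lookup x e)
  | FPair _ _ _ x y z => fun e => lookup z e = (lookup x e, lookup y e)
  | FEntry _ _ _ i v x => fun e => (lookup v e : 'rV_ _) ord0 i = lookup x e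
  | FNot _ q => fun e => ~ sat q e
  | FAnd _ q r => fun e => sat q e /\ sat r e
  | FImp _ q r => fun e => sat q e -> sat r e
  | FAll _ _ A q => fun e => forall x, (lookup A e : set _) x -> sat q (x, e)
  | FEx _ _ A q => fun e => exists2 x, (lookup A e : set _) x & sat q (x, e)
  end.

Fixpoint map_env (X Y : Type) (f : forall t, obj X t -> obj Y t)
    (G : seq stype) : env X G -> env Y G :=
  match G return env X G -> env Y G with
  | [::] => fun e => e
  | t :: G' => fun e => (f t e.1, map_env f e.2)
  end.

Record nsext (R : realType) := NSExt {
  hyper : Type;
  star : forall t, obj R t -> obj hyper t;
  star_individuals : star (t := Pow Ind) [set: R] = [set: hyper];
  transfer : forall (G : seq stype) (p : form G) (e : env R G),
    sat p e <-> sat p (map_env star e)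
}.
Arguments star {R} n t _.

Definition internal (R : realType) (E : nsext R) (t : stype)
    (x : obj (hyper E) t) : Prop :=
  exists A : set (obj R t), (star E (Pow t) A : set _) x.

(* For families of internal sets indexed by [K]: kappa-saturation is
   [saturated K E] for all [K] of cardinality less than kappa. *)
Definition saturated (K : Type) (R : realType) (E : nsext R) : Prop :=
  forall (t : stype) (A : K -> set (obj (hyper E) t)),
    (forall k, internal (E := E) (t := Pow t) (A k)) ->
    (forall s : set K, finite_set s -> \bigcap_(k in s) A k !=set0) ->
    \bigcap_k A k !=set0.

(* If no power set occurs in the type [a], the extension of the set of all
   objects of type [a] consists of all objects of type [a], by transfer; so
   the extension of a function defined on it is again a function. *)

Fixpoint first_order (t : stype) : bool :=
  match t with
  | Ind => true
  | Prod a b => first_order a && first_order b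
  | Vec _ a => first_order a
  | Pow _ => false
  end.

Fixpoint obj0 (R : realType) (t : stype) : obj R t :=
  match t with
  | Ind => 0
  | Prod a b => (obj0 R a, obj0 R b)
  | Vec n a => \row_(_ < n) obj0 R a
  | Pow a => set0
  end.

Lemma sat_conj (X : Type) (G : seq stype) (I : eqType) (p0 : form G)
    (p : I -> form G) (s : seq I) (e : env X G) :
  sat (foldr (fun i q => FAnd (p i) q) (FImp p0 p0) s) e <->
  forall i, i \in s -> sat (p i) e.
Proof.
elim: s => [|i s IHs] /=; first by split.
split=> [[pi /IHs ps] j|ps].
  by rewrite inE => /predU1P[->//|]; exact: ps.
split; first by apply: ps; rewrite mem_head.
by apply/IHs => j js; apply: ps; rewrite inE js orbT.
Qed.

Lemma star_setT (R : realType) (E : nsext R) (t : stype) : first_order t ->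
  star E (Pow t) [set: obj R t] = [set: obj (hyper E) t].
Proof.
elim: t => [_|a IHa b IHb /= /andP[/IHa sa /IHb sb]|n a IHa /= /IHa sa|//].
- exact: star_individuals.
- pose G := [:: Pow a; Pow b; Pow (Prod a b)].
  pose p : form G :=
    FAll (VZ _ _) (FAll (VS _ (VS _ (VZ _ _)))
      (FEx (VS _ (VS _ (VS _ (VS _ (VZ _ _)))))
        (FPair (VS _ (VS _ (VZ _ _))) (VS _ (VZ _ _)) (VZ _ _)))).
  pose e : env R G := ([set: obj R a],
    ([set: obj R b], ([set: obj R (Prod a b)], tt))).
  have /(transfer E) : sat p e by move=> x _ y _ /=; exists (x, y).
  move=> H; apply/seteqP; split=> // -[x y] _.
  have Ax : (star E (Pow a) setT : set _) x by rewrite sa.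
  have By : (star E (Pow b) setT : set _) y by rewrite sb.
  by have [z + <-] := H x Ax y By.
- have Aa x : (star E (Pow a) setT : set _) x by rewrite sa.
  pose G := [:: Pow a; Pow (Vec n a)].
  pose e : env R G := ([set: obj R a], ([set: obj R (Vec n a)], tt)).
  pose c (i : 'I_n) : form [:: Vec n a, a, Vec n a & G] :=
    foldr (fun (j : 'I_n) q => FAnd
        (FAll (VS _ (VS _ (VS _ (VZ _ _))))
          (FImp (FEntry j (VS _ (VS _ (VS _ (VZ _ _)))) (VZ _ _))
                (FEntry j (VS _ (VZ _ _)) (VZ _ _)))) q)
      (FImp (FEq (VZ _ _) (VZ _ _)) (FEq (VZ _ _) (VZ _ _)))
      [seq j <- enum 'I_n | j != i].
  pose p (i : 'I_n) : form G :=
    FAll (VS _ (VZ _ _)) (FAll (VS _ (VZ _ _))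
      (FEx (VS _ (VS _ (VS _ (VZ _ _))))
        (FAnd (FEntry i (VZ _ _) (VS _ (VZ _ _))) (c i)))).
  have Hp i : sat (p i) e.
    move=> v _ x _.
    pose w : obj R (Vec n a) :=
      \row_j if j == i then x else (v : 'rV_n) ord0 j.
    have cw : sat (c i) (w, (x, (v, e)) : env R [:: a, Vec n a & G]).
      apply/sat_conj => j; rewrite mem_filter => /andP[/negPf ji _] y _.
      by rewrite /= mxE ji.
    by exists w => //; split=> //=; rewrite mxE eqxx.
  have {}Hp i := (transfer E _ _).1 (Hp i).
  have [v0 Cv0] : exists v, (star E (Pow (Vec n a)) setT : set _) v.
    exists (star E _ (obj0 R (Vec n a))).
    pose q : form [:: Vec n a; Pow (Vec n a)] := FIn (VZ _ _) (VS _ (VZ _ _)).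
    by have /(transfer E) :
      sat q (obj0 R (Vec n a), ([set: obj R (Vec n a)], tt)) by [].
  apply/seteqP; split=> // v _.
  have key (s : seq 'I_n) : exists2 w, (star E (Pow (Vec n a)) setT : set _) w
      & forall i, i \in s -> (w : 'rV_n) ord0 i = (v : 'rV_n) ord0 i.
    elim: s => [|i s [w Cw ws]]; first by exists v0.
    have [w' Cw' [w'i cw']] := Hp i w Cw ((v : 'rV_n) ord0 i) (Aa _).
    have /sat_conj{}cw' : @sat (hyper E) [:: Vec n a, a, Vec n a & G] (c i)
        (w', ((v : 'rV_n) ord0 i, (w, map_env (star E) e))) := cw'.
    exists w' => // j; rewrite inE; have [->//|ji /= js] := eqVneq j i.
    rewrite -(ws j js); have := cw' j; rewrite mem_filter ji mem_enum.
    by move=> /(_ isT _ (Aa _)); apply.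
  have [w Cw wv] := key (enum 'I_n).
  suff <- : w = v by [].
  by apply/rowP => i; apply: wv; rewrite mem_enum.
Qed.

Definition graph (X Y : Type) (f : X -> Y) : set (X * Y) :=
  [set p | p.2 = f p.1].

Lemma star_graph_total (R : realType) (E : nsext R) (a b : stype)
    (f : obj R a -> obj R b) (x : obj (hyper E) a) : first_order a ->
  exists y, (star E (Pow (Prod a b)) (graph f) : set _) (x, y).
Proof.
move=> fa.
pose p : form [:: Pow (Prod a b); Pow a; Pow b] :=
  FAll (VS _ (VZ _ _)) (FEx (VS _ (VS _ (VS _ (VZ _ _))))
    (FEx (VS _ (VS _ (VZ _ _)))
      (FPair (VS _ (VS _ (VZ _ _))) (VS _ (VZ _ _)) (VZ _ _)))).
have /(transfer E) : sat p
    (graph f : obj R (Pow (Prod a b)), ([set: obj R a], ([set: obj R b], tt))).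
  by move=> u _; exists (f u) => //; exists (u, f u).
have Ax : (star E (Pow a) setT : set _) x by rewrite star_setT.
by move=> /(_ x Ax)[y _ [z Gz zE]]; exists y; rewrite -zE.
Qed.

(* [star_fun E f x] is the value at [x] of the extension of [f], i.e. the
   object (unique, by transfer) that the extension of its graph pairs with
   [x]. *)
Definition star_fun (R : realType) (E : nsext R) (a b : stype)
    (f : obj R a -> obj R b) (fa : first_order a) (x : obj (hyper E) a) :
    obj (hyper E) b :=
  projT1 (cid (star_graph_total f x fa)).

Section Hyperreals.
Context {R : realType} (E : nsext R).

Definition hconst (r : R) : hyper E := star E Ind r.

Definition hlt (x y : hyper E) : Prop :=
  (star E (Pow (Prod Ind Ind)) [set p : R * R | p.1 < p.2] : set _) (x, y).

Definition hle (x y : hyper E) : Prop :=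
  (star E (Pow (Prod Ind Ind)) [set p : R * R | p.1 <= p.2] : set _) (x, y).

Definition hsub (x y : hyper E) : hyper E :=
  star_fun (a := Prod Ind Ind) (b := Ind)
    (fun p : R * R => p.1 - p.2) isT (x, y).

Definition habs (x : hyper E) : hyper E :=
  star_fun (a := Ind) (b := Ind) (fun u : R => `|u| : R) isT x.

Definition positive_infinitesimal (x : hyper E) : Prop :=
  hlt (hconst 0) x /\ forall r : R, 0 < r -> hlt x (hconst r).

(* The extension of [A |-> sup A], defined on the nonempty sets of reals that
   are bounded above.  The value is [+oo] outside the extension of this domain;
   among nonempty internal sets, these are the unbounded ones. *)
Definition hsup (A : set (hyper E)) : \bar (hyper E) :=
  let S : set (hyper E) := [set s |
    (star E (Pow (Prod (Pow Ind) Ind))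
       [set p : set R * R | has_sup p.1 /\ p.2 = sup p.1] : set _) (A, s)] in
  if pselect (exists s, S s) is left h then (projT1 (cid h))%:E else +oo%E.

Definition helt (x y : \bar (hyper E)) : Prop :=
  match x, y with
  | EFin a, EFin b => hlt a b
  | EFin _, EPInf => True
  | ENInf, EFin _ => True
  | ENInf, EPInf => True
  | _, _ => False
  end.

End Hyperreals.

(* The library norm of ['rV[R]_n] is the maximum norm. *)
Definition enorm (R : realType) (n : nat) (x : 'rV[R]_n) : R :=
  Num.sqrt (\sum_(i < n) x ord0 i ^+ 2).

Definition fun0 (R : realType) (n : nat) : Type :=
  {f : 'rV[R]_n -> R | `[< f 0 = 0 >]}.
HB.instance Definition _ (R : realType) (n : nat) :=
  Choice.on (fun0 R n).

Definition germ_eq (R : realType) (n : nat) : rel (fun0 R n) :=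
  fun f g => `[< \forall x \near (0 : 'rV[R]_n), sval f x = sval g x >].

Lemma germ_eq_refl (R : realType) (n : nat) : reflexive (@germ_eq R n).
Proof. by move=> f; apply/asboolP; near=> x. Unshelve. all: by end_near. Qed.

Lemma germ_eq_sym (R : realType) (n : nat) : symmetric (@germ_eq R n).
Proof.
move=> f g; apply: asbool_equiv_eq.
by split; apply: filterS => x ->.
Qed.

Lemma germ_eq_trans (R : realType) (n : nat) : transitive (@germ_eq R n).
Proof.
move=> g f h /asboolP fg /asboolP gh; apply/asboolP.
by apply: filterS2 fg gh => x -> ->.
Qed.

Canonical germ_equiv (R : realType) (n : nat) :=
  EquivRel (@germ_eq R n) (@germ_eq_refl R n) (@germ_eq_sym R n)
    (@germ_eq_trans R n).

Definition germ (R : realType) (n : nat) : Type :=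
  {eq_quot (@germ_eq R n)}%qT.
HB.instance Definition _ (R : realType) (n : nat) :=
  Quotient.on (germ R n).

Definition continuous_germ (R : realType) (n : nat) (u : germ R n) : Prop :=
  exists2 f : fun0 R n, \pi_(germ R n)%qT f = u &
    exists2 U : set 'rV[R]_n, nbhs (0 : 'rV[R]_n) U &
      {within U, continuous (sval f)}.

Section Nets.
Context {R : realType} (E : nsext R) (n : nat).

Definition hball (delta : hyper E) : set 'rV[hyper E]_n :=
  [set xi | hle (star_fun (a := Vec n Ind) (b := Ind) (@enorm R n) isT xi)
                delta].

(* The norm is applied to the extension of a representative of a germ, and to
   the difference of two of these.  For infinitesimal [delta] the choice of
   representatives does not matter. *)
Definition hnorm (delta : hyper E) (F : 'rV[hyper E]_n -> hyper E) :
    \bar (hyper E) :=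
  hsup [set habs (F xi) | xi in hball delta].

Definition star_germ (u : germ R n) : 'rV[hyper E]_n -> hyper E :=
  star_fun (a := Vec n Ind) (b := Ind) (sval (repr u)) isT.

Definition norm_values (delta : hyper E) : set (\bar (hyper E)) :=
  [set hnorm delta (star_germ u) | u in [set: germ R n]].

(* [le] is reflexive on a directed set; a strict comparison of [d] with [d0]
   would make the condition vacuous when [D] has a greatest element. *)
Definition tau_converges (delta : hyper E) (D : Type) (le : D -> D -> Prop)
    (f : D -> germ R n) (g : germ R n) : Prop :=
  forall r, norm_values delta r -> helt (hconst E 0)%:E r ->
    exists d0, forall d, le d0 d ->
      helt (hnorm delta (fun xi => hsub (star_germ (f d) xi) (star_germ g xi)))
           r.

End Nets.

Definition directed_set (D : Type) (le : D -> D -> Prop) : Prop :=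
  [/\ inhabited D, forall a, le a a,
      forall a b c, le a b -> le b c -> le a c &
      forall a b, exists2 c, le a c & le b c].

(* Main.v *)
(* If g is discontinuous at points arbitrarily close to 0, let phi(t) be half the
   supremum of the oscillations of g at the points of norm < t, truncated at 1.
   A function continuous on the ball of radius t is at uniform distance at least
   phi(t) from g there.  The germ of h(x) = phi(|x|) has norm r > 0 on B_delta,
   and the norm of h on a ball of small standard radius t is at most phi(t); by
   transfer no continuous germ is at distance < r from g on B_delta, so no net of
   continuous germs converges to g. *)

Require Import Defs.
From mathcomp Require Import all_boot all_order all_algebra.
From mathcomp Require Import all_classical all_reals all_analysis.
From mathcomp Require Import lra.

Set Implicit Arguments.
Unset Strict Implicit.
Unset Printing Implicit Defensive.

Import Order.TTheory GRing.Theory Num.Theory.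
Import numFieldNormedType.Exports.

Local Open Scope classical_set_scope.
Local Open Scope ring_scope.

(** De Bruijn indices: [v0] is the innermost bound variable, and under m quantifiers the parameters
    of a formula start at index m. *)
Local Notation v0 := (VZ _ _).
Local Notation v1 := (VS _ v0).
Local Notation v2 := (VS _ v1).
Local Notation v3 := (VS _ v2).
Local Notation v4 := (VS _ v3).
Local Notation v5 := (VS _ v4).
Local Notation v6 := (VS _ v5).
Local Notation v7 := (VS _ v6).
Local Notation v8 := (VS _ v7).
Local Notation v9 := (VS _ v8).

Lemma graphE (X Y : Type) (f : X -> Y) x y : graph f (x, y) = (y = f x).
Proof. by []. Qed.

(** * Transfer for sets, functions and images *)

Section Transfer.
Context {R : realType} (E : nsext R).
Local Notation H := (hyper E).

Definition star_set (a : stype) (P : set (obj R a)) : set (obj H a) :=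
  star E (Pow a) P.

(** Two premises make this an inference rule: facts transferred separately to one point can be
    combined there without writing a new formula. *)
Lemma star_setI_sub (a : stype) (P Q S : set (obj R a)) :
  P `&` Q `<=` S -> star_set P `&` star_set Q `<=` star_set S.
Proof.
move=> PQS x [Px Qx].
pose p : Defs.form [:: Pow a; Pow a; Pow a] :=
  FAll v0 (FImp (FIn v0 v2) (FIn v0 v3)).
have /(transfer E) : sat p
    (P : obj R (Pow a), (Q : obj R (Pow a), (S : obj R (Pow a), tt))).
  by move=> y Py Qy; apply: PQS.
by move=> /(_ x Px Qx).
Qed.

Lemma star_sub (a : stype) (P Q : set (obj R a)) :
  P `<=` Q -> star_set P `<=` star_set Q.
Proof.
by move=> PQ x Px; apply: (@star_setI_sub _ P P) => // y [/PQ].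
Qed.

Lemma star_set0 (a : stype) : @star_set a set0 = set0.
Proof.
apply/seteqP; split=> // x x0.
pose p : Defs.form [:: Pow a] := FAll v0 (FNot (FIn v0 v1)).
have /(transfer E) : sat p (set0 : obj R (Pow a), tt) by [].
by move=> /(_ x x0).
Qed.

Lemma star_disjoint (a : stype) (P Q : set (obj R a)) x :
  P `&` Q = set0 -> star_set P x -> ~ star_set Q x.
Proof.
move=> PQ Px Qx; suff : @star_set a set0 x by rewrite star_set0.
by apply: (@star_setI_sub a P Q); rewrite ?PQ.
Qed.

(** Quantifiers are bounded, so instantiating a transferred formula requires membership in the
    extension of a full type. For types containing [Pow] this extension need not be everything; here
    membership comes from occurring in a pair. *)
Lemma star_pair_mem (a b : stype) (G : set (obj R a * obj R b)) x y :
  star_set (a := Prod a b) G (x, y) ->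
  star_set (a := a) setT x /\ star_set (a := b) setT y.
Proof.
move=> Gxy.
pose p : Defs.form [:: Pow (Prod a b); Pow a; Pow b] :=
  FAll v0 (FEx v2 (FEx v4 (FPair v1 v0 v2))).
have /(transfer E) : sat p (G : obj R (Pow (Prod a b)),
    ([set: obj R a], ([set: obj R b], tt))).
  by move=> [u v] _; exists u => //; exists v.
by move=> /(_ _ Gxy)[x' x'A [y' y'B [-> ->]]].
Qed.

Lemma star_functional (a b : stype) (G : set (obj R a * obj R b)) x y z :
  (forall u v w, G (u, v) -> G (u, w) -> v = w) ->
  star_set (a := Prod a b) G (x, y) -> star_set (a := Prod a b) G (x, z) ->
  y = z.
Proof.
move=> Gfun Gxy Gxz.
pose p : Defs.form [:: Pow (Prod a b); Pow a; Pow b] :=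
  FAll v0 (FAll v1 (FAll v3 (FAll v5 (FAll v6
    (FImp (FPair v2 v1 v4) (FImp (FPair v2 v0 v3) (FEq v1 v0))))))).
have /(transfer E) : sat p (G : obj R (Pow (Prod a b)),
    ([set: obj R a], ([set: obj R b], tt))).
  by move=> [u v] Gp [u' w] Gq k _ l _ m _ /= [? ?] [? ?]; subst; apply: Gfun Gq.
have [xA yB] := star_pair_mem Gxy; have [_ zB] := star_pair_mem Gxz.
by move=> /(_ _ Gxy _ Gxz _ xA _ yB _ zB); apply.
Qed.

Lemma star_graphP (a b : stype) (f : obj R a -> obj R b) (fa : first_order a)
    (x : obj H a) (y : obj H b) :
  star_set (a := Prod a b) (graph f) (x, y) <-> y = star_fun f fa x.
Proof.
have Gx : star_set (a := Prod a b) (graph f) (x, star_fun f fa x).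
  by rewrite /star_fun; case: cid.
split=> [Gy|->//].
apply: (star_functional _ Gy Gx) => u v w vE wE; exact: etrans vE (esym wE).
Qed.

(** Together with [star_fun_pair], this replaces explicit formulas: a relation between values of
    standard functions is transferred as the preimage of a standard set. *)
Lemma star_preimage (a b : stype) (f : obj R a -> obj R b)
    (fa : first_order a) (P : set (obj R b)) (x : obj H a) :
  star_set (f @^-1` P) x <-> star_set P (star_fun f fa x).
Proof.
pose p : Defs.form [:: Pow (Prod a b); Pow a; Pow b; Pow a; Pow b] :=
  FAll v0 (FAll v2 (FAll v4 (FImp (FPair v1 v0 v2)
    (FAnd (FImp (FIn v1 v6) (FIn v0 v7)) (FImp (FIn v0 v7) (FIn v1 v6)))))).
have /(transfer E) : sat p (graph f : obj R (Pow (Prod a b)),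
    ([set: obj R a], ([set: obj R b],
    (f @^-1` P : obj R (Pow a), (P : obj R (Pow b), tt))))).
  by move=> [u v] /= /[!graphE] -> k _ l _ [<- <-].
have Gx := (star_graphP f fa x _).2 erefl.
have [xA yB] := star_pair_mem Gx.
by move=> /(_ _ Gx _ xA _ yB erefl).
Qed.

Lemma star_fun_pair (a b c : stype) (f : obj R a -> obj R b)
    (g : obj R a -> obj R c) (fa : first_order a) (x : obj H a) :
  star_fun (b := Prod b c) (fun u => (f u, g u)) fa x =
  (star_fun f fa x, star_fun g fa x).
Proof.
pose h u : obj R (Prod b c) := (f u, g u).
pose p : Defs.form [:: Pow (Prod a b); Pow (Prod a c); Pow (Prod a (Prod b c));
    Pow (Prod b c); Pow a; Pow b; Pow c] :=
  FAll v0 (FAll v2 (FAll v6 (FAll v8 (FAll (VS _ (VS _ v8))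
    (FImp (FPair v2 v1 v4) (FImp (FPair v2 v0 v3)
      (FEx v7 (FEx v9 (FAnd (FPair v3 v2 v0) (FPair v4 v0 v1)))))))))).
have /(transfer E) : sat p (graph f : obj R (Pow (Prod a b)),
    (graph g : obj R (Pow (Prod a c)),
    (graph h : obj R (Pow (Prod a (Prod b c))),
    ([set: obj R (Prod b c)],
    ([set: obj R a], ([set: obj R b], ([set: obj R c], tt))))))).
  move=> [u v] /= /[!graphE] -> [u' w] /= /[!graphE] -> k _ l _ m _ [<- <-] [<- <-].
  by exists (u', h u') => //; exists (h u').
have Gf := (star_graphP f fa x _).2 erefl.
have Gg := (star_graphP g fa x _).2 erefl.
have [xA yB] := star_pair_mem Gf; have [_ zC] := star_pair_mem Gg.
move=> /(_ _ Gf _ Gg _ xA _ yB _ zC erefl erefl)[q Gq [w wBC] [/= wE qE]].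
by symmetry; apply/(star_graphP h fa); rewrite -wE -qE.
Qed.

(** The pairing of [g] with [f \o g] maps every point into the graph of [f]. Hence the preimage of
    that graph is the full type, whose extension is full because [a] is first order. *)
Lemma star_fun_comp (a b c : stype) (f : obj R b -> obj R c)
    (g : obj R a -> obj R b) (fa : first_order a) (fb : first_order b)
    (x : obj H a) :
  star_fun (f \o g) fa x = star_fun f fb (star_fun g fa x).
Proof.
apply/star_graphP; rewrite -(star_fun_pair g (f \o g)).
apply/star_preimage.
by apply: (@star_sub _ setT) => //; rewrite /star_set star_setT.
Qed.

Lemma star_fun_id (a : stype) (fa : first_order a) (x : obj H a) :
  star_fun (a := a) (b := a) id fa x = x.
Proof.
pose p : Defs.form [:: Pow (Prod a a); Pow a] :=
  FAll v1 (FEx v1 (FPair v1 v1 v0)).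
have /(transfer E) : sat p
    (graph id : obj R (Pow (Prod a a)), ([set: obj R a], tt)).
  by move=> u _; exists (u, u).
have xA : star_set (a := a) setT x by rewrite /star_set star_setT.
by move=> /(_ _ xA)[q Gq qE]; symmetry; apply/star_graphP; rewrite -qE.
Qed.

Lemma star_fun_cst (a b : stype) (c : obj R b) (fa : first_order a)
    (x : obj H a) : star_fun (fun=> c) fa x = star E b c.
Proof.
pose p : Defs.form [:: Pow (Prod a b); Pow a; b] :=
  FAll v1 (FEx v1 (FPair v1 v4 v0)).
have /(transfer E) : sat p
    (graph (fun=> c) : obj R (Pow (Prod a b)), ([set: obj R a], (c, tt))).
  by move=> u _; exists (u, c).
have xA : star_set (a := a) setT x by rewrite /star_set star_setT.
by move=> /(_ _ xA)[q Gq qE]; symmetry; apply/star_graphP; rewrite -qE.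
Qed.

Lemma star_fun_fst (a b : stype) (fab : first_order (Prod a b))
    (x : obj H a) (y : obj H b) :
  star_fun (a := Prod a b) (b := a) fst fab (x, y) = x.
Proof.
pose p : Defs.form [:: Pow (Prod (Prod a b) a); Pow a; Pow b; Pow (Prod a b)] :=
  FAll v1 (FAll v3 (FAll v5 (FImp (FPair v2 v1 v0)
    (FEx v3 (FPair v1 v3 v0))))).
have /(transfer E) : sat p
    (graph fst : obj R (Pow (Prod (Prod a b) a)),
      ([set: obj R a], ([set: obj R b], ([set: obj R (Prod a b)], tt)))).
  by move=> u _ v _ q _ /= ->; exists ((u, v), u).
have /andP[fa fb] := fab.
have xA : star_set (a := a) setT x by rewrite /star_set star_setT.
have yB : star_set (a := b) setT y by rewrite /star_set star_setT.
have xyAB : star_set (a := Prod a b) setT (x, y) by rewrite /star_set star_setT.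
move=> /(_ _ xA _ yB _ xyAB erefl)[q Gq qE].
by symmetry; apply/star_graphP; rewrite -qE.
Qed.

Lemma star_fun_snd (a b : stype) (fab : first_order (Prod a b))
    (x : obj H a) (y : obj H b) :
  star_fun (a := Prod a b) (b := b) snd fab (x, y) = y.
Proof.
pose p : Defs.form [:: Pow (Prod (Prod a b) b); Pow a; Pow b; Pow (Prod a b)] :=
  FAll v1 (FAll v3 (FAll v5 (FImp (FPair v2 v1 v0)
    (FEx v3 (FPair v1 v2 v0))))).
have /(transfer E) : sat p
    (graph snd : obj R (Pow (Prod (Prod a b) b)),
      ([set: obj R a], ([set: obj R b], ([set: obj R (Prod a b)], tt)))).
  by move=> u _ v _ q _ /= ->; exists ((u, v), v).
have /andP[fa fb] := fab.
have xA : star_set (a := a) setT x by rewrite /star_set star_setT.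
have yB : star_set (a := b) setT y by rewrite /star_set star_setT.
have xyAB : star_set (a := Prod a b) setT (x, y) by rewrite /star_set star_setT.
move=> /(_ _ xA _ yB _ xyAB erefl)[q Gq qE].
by symmetry; apply/star_graphP; rewrite -qE.
Qed.

(** Extension of a set-valued map is computed fibrewise. This identifies the values taken on a
    nonstandard ball with the value at its radius of a standard set-valued function. *)
Lemma star_fun_image (a b c : stype) (u : obj R a -> obj R b)
    (V : set (obj R a * obj R c)) (fa : first_order a) (fc : first_order c)
    (t : obj H c) :
  star_fun (a := c) (b := Pow b)
    (fun s => [set u x | x in [set x | V (x, s)]]) fc t =
  [set star_fun u fa x | x in [set x | star_set (a := Prod a c) V (x, t)]].
Proof.
pose I s : obj R (Pow b) := [set u x | x in [set x | V (x, s)]].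
pose p : Defs.form [:: Pow (Prod c (Pow b)); Pow (Prod a b); Pow (Prod a c);
    Pow a; Pow b; Pow c; Pow (Pow b)] :=
  FAll v0 (FAll v6 (FAll v8 (FImp (FPair v1 v0 v2) (FAnd
    (* The first conjunct says that each member of the value is the image of a fibre point; the
       second, that each such image is a member. *)
    (FAll v0 (FEx v7 (FEx v7 (FEx v7
      (FAnd (FPair v2 v5 v1) (FPair v2 v3 v0))))))
    (FAll v6 (FAll v6 (FAll v6 (FAll (VS _ v9)
      (FImp (FPair v3 v5 v2) (FImp (FPair v3 v0 v1) (FIn v0 v4))))))))))).
have /(transfer E) : sat p (graph I : obj R (Pow (Prod c (Pow b))),
    (graph u : obj R (Pow (Prod a b)),
    (V : obj R (Pow (Prod a c)),
    ([set: obj R a], ([set: obj R b], ([set: obj R c],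
    ([set: obj R (Pow b)], tt))))))).
  move=> [s A] /= /[!graphE] -> s' _ A' _ [<- <-]; split.
    move=> _ [x Vx <-]; exists x => //.
    by exists (x, s) => //; exists (x, u x).
  by move=> x _ [x1 s1] V1 [x2 y2] /= /[!graphE] -> y _ [? ?] [? ?]; subst; exists x.
have Gt := (star_graphP I fc t _).2 erefl.
have [tC AB] := star_pair_mem Gt.
move=> /(_ _ Gt _ tC _ AB erefl)[IA AI].
apply/seteqP; split=> [y /IA /=[x _ [q Vq [r Gr [qE rE]]]]|_ [x Vx <-]].
  rewrite qE in Vq; rewrite rE in Gr; exists x => //.
  by symmetry; apply/star_graphP.
have Gx := (star_graphP u fa x _).2 erefl.
have [xA yB] := star_pair_mem Gx.
exact: (AI _ xA _ Vx _ Gx _ yB).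
Qed.

End Transfer.

(** * Euclidean norm, representatives of germs and oscillation over the reals *)

Section Standard.
Context {R : realType} {n : nat}.
Implicit Types (x y : 'rV[R]_n) (f g : 'rV[R]_n -> R) (t : R).

Lemma enorm_continuous : continuous (@enorm R n).
Proof.
move=> x; rewrite /enorm.
apply: (@continuous_comp _ _ _ (fun x : 'rV[R]_n => \sum_(i < n) x ord0 i ^+ 2)
  Num.sqrt); last exact: sqrt_continuous.
apply: cvg_big; [exact: add_continuous|exact: nbhs_filter|].
move=> i _.
apply: (@continuous_comp _ _ _ (fun x : 'rV[R]_n => x ord0 i) (fun u : R => u ^+ 2)).
  exact: coord_continuous.
exact: exprn_continuous.
Qed.

Lemma enorm0 : enorm (0 : 'rV[R]_n) = 0.
Proof. by rewrite /enorm big1 ?sqrtr0// => i _; rewrite mxE expr0n. Qed.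

Lemma enormZ (c : R) x : enorm (c *: x) = `|c| * enorm x.
Proof.
rewrite /enorm -sqrtr_sqr -sqrtrM ?sqr_ge0// mulr_sumr.
by congr Num.sqrt; apply: eq_bigr => i _; rewrite mxE exprMn.
Qed.

Lemma enorm_ge0 x : 0 <= enorm x.
Proof. exact: sqrtr_ge0. Qed.

Lemma le_norm_enorm x : `|x| <= enorm x.
Proof.
rewrite [leLHS]/Num.Def.normr/= mx_normrE (bigmax_le _ (enorm_ge0 x))//=.
move=> -[i j] _ /=; rewrite (ord1 i) -sqrtr_sqr ler_sqrt; last first.
  by apply: sumr_ge0 => k _; exact: sqr_ge0.
by rewrite (bigD1 j)//= lerDl sumr_ge0// => k _; exact: sqr_ge0.
Qed.

Lemma enorm_gt0 x : x != 0 -> 0 < enorm x.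
Proof. by rewrite -normr_gt0 => /lt_le_trans; apply; exact: le_norm_enorm. Qed.

Lemma near_enorm_lt t x : enorm x < t -> \forall y \near x, enorm y < t.
Proof. by move=> xt; exact: (cvgr_lt (enorm x) (enorm_continuous (x := x))). Qed.

(** One direction uses that [enorm] dominates the maximum norm; the other needs only continuity of
    [enorm] at 0, so no constant comparing the norms enters. *)
Lemma nbhs0_enormP (U : set 'rV[R]_n) : nbhs (0 : 'rV[R]_n) U <->
  exists2 t, 0 < t & forall x, enorm x < t -> U x.
Proof.
split=> [/nbhs_normP[t /= t0 tU]|[t t0 tU]].
  exists t => // x xt; apply: tU => /=; rewrite sub0r normrN.
  exact: le_lt_trans (le_norm_enorm x) xt.
by apply: filterS tU _; apply: near_enorm_lt; rewrite enorm0.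
Qed.

Lemma repr_pi_near (h : fun0 R n) :
  \forall x \near (0 : 'rV[R]_n),
    sval (repr (\pi_(germ R n)%qT h)) x = sval h x.
Proof.
suff /asboolP : @germ_eq R n (repr (\pi_(germ R n)%qT h)) h by [].
by apply/(@eqmodP _ (germ_equiv R n)); rewrite reprK.
Qed.

(** Continuity passes to the canonical representative because it is local: on a small ball both
    representatives agree, and at interior points of [U] the subspace neighbourhoods are the ambient
    ones. *)
Lemma continuous_germP (u : germ R n) : continuous_germ u <->
  exists2 t, 0 < t &
    forall x, enorm x < t -> {for x, continuous (sval (repr u))}.
Proof.
split=> [[f <- [U U0 fU]]|[t t0 ut]]; last first.
  exists (repr u); first exact: reprK.
  exists [set x | enorm x < t]; first by apply/nbhs0_enormP; exists t.
  apply: continuous_in_subspaceT => x /set_mem /= xt; exact: ut.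
have /nbhs0_enormP[t t0 tV] :
  nbhs (0 : 'rV[R]_n)
    (U `&` [set x | sval (repr (\pi_(germ R n)%qT f)) x = sval f x]).
  by apply: filterI => //; exact: repr_pi_near.
exists t => // x xt.
have nt := near_enorm_lt xt.
have fx : {for x, continuous (sval f)}.
  have xU : U° x by apply: filterS nt => y /tV[].
  rewrite /continuous_at/= /prop_for/= (nbhs_subspace_interior xU); exact: fU.
rewrite /continuous_at /prop_for /=; have [_ /= ->] := tV _ xt.
apply: cvg_trans fx; apply: near_eq_cvg; first exact: nbhs_filter.
by apply: filterS nt => y /tV[].
Qed.

(** The factor 1/2 comes from the triangle inequality: if [f] is continuous at x and within [c] of
    [g], then [g] eventually varies by less than e near x for every e above 2[c]. *)
Lemma discontinuity_modulus g :
  (forall t, 0 < t -> exists2 x, enorm x < t & ~ {for x, continuous g}) ->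
  exists phi : R -> R, [/\ phi 0 = 0, forall t, 0 < t -> 0 < phi t,
    {homo phi : s t / s <= t} &
    forall f t c, 0 < t ->
      (forall x, enorm x < t -> {for x, continuous f}) ->
      (forall x, enorm x < t -> `|f x - g x| <= c) -> phi t <= c].
Proof.
move=> gdisc.
(* Adjoining 0 keeps [S t] nonempty for every [t], and the cap 1 keeps it bounded even where [g] is
   not, so [sup] never takes its default value. *)
pose S t : set R := [set e | e <= 1 /\ (e = 0 \/ exists2 x, enorm x < t &
  ~ \forall y \near x, `|g x - g y| < e)].
have S0 t : S t 0 by split; [rewrite ler01|left].
have Sub t : has_ubound (S t) by exists 1 => e [].
have Ssup t : has_sup (S t) by split; [exists 0|].
exists (fun t => sup (S t) / 2); split.
(* The strict inequality in [enorm x < t] matters: no point has norm below 0. *)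
- suff -> : S 0 = [set 0] by rewrite sup1 mul0r.
  apply/seteqP; split=> [e [_ [//|[x]]]|_ ->//].
  by rewrite ltNge enorm_ge0.
- move=> t t0; have [x xt gx] := gdisc t t0; rewrite divr_gt0//.
  have {}gx : ~ (g @ x --> g x) := gx.
  have [e e0 ge] : exists2 e, 0 < e & ~ \forall y \near x, `|g x - g y| < e.
    apply: contra_notP gx => ge.
    apply/(@cvgrPdist_lt _ _ _ (nbhs x) (nbhs_filter x)) => e e0.
    by apply: contra_notP ge => ge; exists e.
  (* Lowering the threshold to at most 1 respects the truncation and keeps it a witness of
     discontinuity. *)
  apply: (@lt_le_trans _ _ (Num.min 1 e)); first by rewrite lt_min ltr01.
  apply: ub_le_sup => //; split; first by rewrite ge_min lexx.
  right; exists x => //; apply: contra_not ge; apply: filterS => y.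
  by rewrite lt_min => /andP[].
- move=> s t st; rewrite ler_pM2r ?invr_gt0//.
  apply: sup_le => //; last by exists 0.
  move=> e Se; exists e; split=> //; case: Se => e1 Se; split=> //.
  by case: Se => [|[x xs ge]]; [left|right; exists x => //; exact: lt_le_trans st].
- move=> f t c t0 fcont fg.
  have c0 : 0 <= c by apply: le_trans (fg 0 _); rewrite ?enorm0.
  rewrite ler_pdivrMr//; apply: ge_sup; first by exists 0.
  move=> e [_ [->|[x xt]]]; first by rewrite mulr_ge0.
  apply: contra_notP => /negP; rewrite -ltNge => ce.
  have ec : 0 < e - c * 2 by rewrite subr_gt0.
  have /(@cvgrPdist_lt _ _ _ (nbhs x) (nbhs_filter x)) fx := fcont x xt.
  apply: filterS2 (near_enorm_lt xt) (fx _ ec) => y yt fxy.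
  have := fg x xt; have := fg y yt; move: fxy.
  rewrite !ltr_norml !ler_norml => /andP[? ?] /andP[? ?] /andP[? ?].
  by apply/andP; split; lra.
Qed.

End Standard.

(** * The norm on a ball as the extension of a function of the radius *)

Section BallNorm.
Context {R : realType} (E : nsext R) (n : nat).
Local Notation H := (hyper E).
Implicit Types (u v : 'rV[R]_n -> R) (t : R) (delta : H).

(** The closed ball is written as a fibre of a set of pairs, the shape required by
    [star_fun_image]. *)
Definition ball_image u t : set R :=
  [set u x | x in [set x | [set p : 'rV[R]_n * R | enorm p.1 <= p.2] (x, t)]].

Lemma hballP delta (xi : 'rV[H]_n) : hball delta xi <->
  star_set (E := E) (a := Prod (Vec n Ind) Ind) [set p | enorm p.1 <= p.2]
    (xi, delta).
Proof.
pose k (p : 'rV[R]_n * R) : R * R := (enorm p.1, p.2).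
have kE : star_fun (a := Prod (Vec n Ind) Ind) (b := Prod Ind Ind) k isT
    (xi, delta) =
    (star_fun (a := Vec n Ind) (b := Ind) (@enorm R n) isT xi, delta).
  rewrite (@star_fun_pair R E (Prod (Vec n Ind) Ind) Ind Ind (@enorm R n \o fst) snd).
  rewrite (@star_fun_comp R E (Prod (Vec n Ind) Ind) (Vec n Ind) Ind
    (@enorm R n) fst isT isT).
  by rewrite star_fun_fst star_fun_snd.
have := @star_preimage R E (Prod (Vec n Ind) Ind) (Prod Ind Ind) k isT
  [set p | p.1 <= p.2] (xi, delta).
by rewrite kE => kP; symmetry; exact: kP.
Qed.

(** Presents the norm as a supremum of a standard set-valued function evaluated at [delta], so that
    its properties can be read off from standard radii. *)
Lemma hnormE delta u (F : 'rV[H]_n -> H) :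
  (forall xi, habs (F xi) = star_fun (a := Vec n Ind) (b := Ind) u isT xi) ->
  hnorm delta F =
  hsup (star_fun (a := Ind) (b := Pow Ind) (ball_image u) isT delta).
Proof.
move=> Fu; congr hsup.
rewrite (@star_fun_image R E (Vec n Ind) Ind Ind u
  [set p | enorm p.1 <= p.2] isT isT).
by apply/seteqP; split=> _ [xi /hballP xiB <-]; exists xi.
Qed.

Lemma habs_star_fun u (xi : 'rV[H]_n) :
  habs (star_fun (a := Vec n Ind) (b := Ind) u isT xi) =
  star_fun (a := Vec n Ind) (b := Ind) (fun x => `|u x|) isT xi.
Proof.
by symmetry; apply: (@star_fun_comp R E (Vec n Ind) Ind Ind (fun r : R => `|r|) u).
Qed.

Lemma hsub_star_fun u v (xi : 'rV[H]_n) :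
  hsub (star_fun (a := Vec n Ind) (b := Ind) u isT xi)
    (star_fun (a := Vec n Ind) (b := Ind) v isT xi) =
  star_fun (a := Vec n Ind) (b := Ind) (fun x => u x - v x) isT xi.
Proof.
rewrite /hsub -(@star_fun_pair R E (Vec n Ind) Ind Ind u v).
symmetry; apply: (@star_fun_comp R E (Vec n Ind) (Prod Ind Ind) Ind
  (fun p : R * R => p.1 - p.2) (fun x => (u x, v x))).
Qed.

Lemma star_lt_cst (f g : R -> R) delta :
  star_set (E := E) (a := Ind) [set t | f t < g t] delta <->
  hlt (star_fun (a := Ind) (b := Ind) f isT delta)
    (star_fun (a := Ind) (b := Ind) g isT delta).
Proof.
rewrite /hlt -(@star_fun_pair R E Ind Ind Ind f g).
exact: (@star_preimage R E Ind (Prod Ind Ind) (fun t => (f t, g t)) isT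
  [set p | p.1 < p.2]).
Qed.

(** A positive infinitesimal lies in the extension of the interval from 0 to [t0]. Whatever holds at
    all small positive real radii therefore holds at [delta]. *)
Lemma star_infinitesimal delta (P : set R) t0 :
  positive_infinitesimal delta -> 0 < t0 ->
  (forall t, 0 < t -> t < t0 -> P t) -> star_set (E := E) (a := Ind) P delta.
Proof.
move=> [delta0 deltaE] t00 tP.
apply: (@star_setI_sub R E Ind [set t | 0 < t] [set t | t < t0]).
  by move=> t [/= ? ?]; apply: tP.
split.
  apply/(star_lt_cst (fun=> 0) id).
  by rewrite (star_fun_cst (b := Ind)) star_fun_id.
apply/(star_lt_cst id (fun=> t0)).
by rewrite (star_fun_cst (b := Ind)) star_fun_id; exact: deltaE.
Qed.

Definition sup_graph : set (set R * R) :=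
  [set p | has_sup p.1 /\ p.2 = sup p.1].

Lemma hsup_sup_graph (A : set H) (s : H) :
  star_set (E := E) (a := Prod (Pow Ind) Ind) sup_graph (A, s) -> hsup A = s%:E.
Proof.
move=> As; rewrite /hsup; case: pselect => [h|[]]; last by exists s.
case: cid => s' As' /=; congr EFin.
apply: (@star_functional R E (Pow Ind) Ind sup_graph A) As' As.
by move=> B x y [_ /= xE] [_ /= yE]; rewrite xE yE.
Qed.

(** The value [+oo] is not below a finite one, so the strict inequality itself shows that the
    supremum exists. *)
Lemma helt_hsup (A : set H) (s : H) : helt (hsup A) s%:E ->
  exists2 a, star_set (E := E) (a := Prod (Pow Ind) Ind) sup_graph (A, a) & hlt a s.
Proof.
rewrite /hsup; case: pselect => [h|//].
by case: cid => a Aa /= las; exists a.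
Qed.

Lemma hsup_ball_image delta u t0 :
  positive_infinitesimal delta -> 0 < t0 ->
  (forall t, 0 < t -> t < t0 -> has_sup (ball_image u t)) ->
  hsup (star_fun (a := Ind) (b := Pow Ind) (ball_image u) isT delta) =
  (star_fun (a := Ind) (b := Ind) (fun t => sup (ball_image u t)) isT delta)%:E.
Proof.
move=> dinf t00 usup; apply: hsup_sup_graph.
rewrite -(@star_fun_pair R E Ind (Pow Ind) Ind (ball_image u)).
apply/(@star_preimage R E Ind (Prod (Pow Ind) Ind)
  (fun t => (ball_image u t, sup (ball_image u t))) isT).
by apply: (star_infinitesimal dinf t00) => t tpos tt0; split=> //; apply: usup.
Qed.

(** The values of [u] may be unbounded, so the comparison is assumed only at radii where their
    supremum exists. An infinite norm of [u] cannot be smaller than the finite norm of [v]. *)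
Lemma hsup_ball_image_nlt delta u v t0 :
  positive_infinitesimal delta -> 0 < t0 ->
  (forall t, 0 < t -> t < t0 -> has_sup (ball_image v t)) ->
  (forall t, 0 < t -> t < t0 -> has_sup (ball_image u t) ->
    sup (ball_image v t) <= sup (ball_image u t)) ->
  ~ helt (hsup (star_fun (a := Ind) (b := Pow Ind) (ball_image u) isT delta))
      (hsup (star_fun (a := Ind) (b := Pow Ind) (ball_image v) isT delta)).
Proof.
move=> dinf t00 vsup uv; rewrite (hsup_ball_image dinf t00 vsup).
move=> /helt_hsup[a ua av].
pose T : set R := [set t | 0 < t < t0].
have dT : star_set (E := E) (a := Ind) T delta.
  by apply: (star_infinitesimal dinf t00) => t ? ?; apply/andP.
(* Three standard conditions on a pair (radius, value) are shown to hold at ([delta], [a]); no real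
   pair satisfies all three, which is the contradiction. *)
have daT : star_set (E := E) (a := Prod Ind Ind) (fst @^-1` T) (delta, a).
  apply/(@star_preimage R E (Prod Ind Ind) Ind fst isT T).
  by rewrite star_fun_fst.
have daS : star_set (E := E) (a := Prod Ind Ind)
    [set p | sup_graph (ball_image u p.1, p.2)] (delta, a).
  apply/(@star_preimage R E (Prod Ind Ind) (Prod (Pow Ind) Ind)
    (fun p => (ball_image u p.1, p.2)) isT sup_graph).
  rewrite (@star_fun_pair R E (Prod Ind Ind) (Pow Ind) Ind (ball_image u \o fst) snd).
  rewrite (@star_fun_comp R E (Prod Ind Ind) Ind (Pow Ind)
    (ball_image u) fst isT isT).
  by rewrite star_fun_fst star_fun_snd.
have daL : star_set (E := E) (a := Prod Ind Ind)
    [set p | p.2 < sup (ball_image v p.1)] (delta, a).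
  apply/(@star_preimage R E (Prod Ind Ind) (Prod Ind Ind)
    (fun p => (p.2, sup (ball_image v p.1))) isT [set p | p.1 < p.2]).
  rewrite (@star_fun_pair R E (Prod Ind Ind) Ind Ind snd
    ((fun t => sup (ball_image v t)) \o fst)).
  rewrite (@star_fun_comp R E (Prod Ind Ind) Ind Ind
    (fun t => sup (ball_image v t)) fst isT isT).
  by rewrite star_fun_fst star_fun_snd.
have : star_set (E := E) (a := Prod Ind Ind) (~` (fst @^-1` T)) (delta, a).
  apply: (@star_setI_sub R E (Prod Ind Ind) _ _ _ _ _ (conj daS daL)).
  move=> [t b] [/= [/= us ->]] tv /andP[t0' tt0].
  by have := uv t t0' tt0 us; rewrite leNgt tv.
by apply: star_disjoint daT; rewrite setICr.
Qed.

End BallNorm.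

(** * Limits of nets of continuous germs *)

Theorem theorem10p1 (R : realType) (E : nsext R)
    (K : Type) (satK : saturated K E)
    (n : nat) (delta : hyper E) (delta_inf : positive_infinitesimal delta)
    (D : Type) (le : D -> D -> Prop) (dirD : directed_set le)
    (f : D -> germ R n) (f_cont : forall d, continuous_germ (f d))
    (g : germ R n) (f_cvg : tau_converges delta le f g) :
  continuous_germ g.
Proof.
apply: contrapT => gdisc.
have /discontinuity_modulus[phi [phi0 phi_gt0 phi_mono phi_le]] : forall t,
    0 < t -> exists2 x, enorm x < t & ~ {for x, continuous (sval (repr g))}.
  move=> t t0; apply: contra_notP gdisc => gt.
  apply/continuous_germP; exists t => // x xt.
  by apply: contra_notP gt => gx; exists x.
(* If 0 is the only vector, every function is continuous, against [gdisc]. A nonzero vector is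
   wanted below to reach points of every prescribed norm. *)
have [z z0] : exists z : 'rV[R]_n, z != 0.
  apply: contra_notP gdisc => z0; apply/continuous_germP.
  exists 1 => // x _.
  have xE (y : 'rV[R]_n) : y = x.
    suff all0 (y' : 'rV[R]_n) : y' = 0 by rewrite (all0 y) (all0 x).
    by apply: contra_notP z0 => /eqP; exists y'.
  apply/(@cvgrPdist_lt _ _ _ (nbhs x) (nbhs_filter x)) => e e0.
  by apply: nearW => y; rewrite (xE y) subrr normr0.
have h0 : `[< phi (enorm (0 : 'rV[R]_n)) = 0 >].
  by apply/asboolP; rewrite enorm0.
pose h : fun0 R n := exist _ (fun x => phi (enorm x)) h0.
pose hg : germ R n := (\pi_(germ R n) h)%qT.
(* The norm is computed with [repr hg], which is known to agree with [h] only near 0; [t1] is a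
   radius of agreement. *)
have [t1 t10 ht] := (nbhs0_enormP _).1 (repr_pi_near h).
pose v x := `|sval (repr hg) x|.
have vE x : enorm x < t1 -> v x = phi (enorm x).
  move=> xt; rewrite /v ht//= ger0_norm// -phi0.
  by apply: phi_mono; exact: enorm_ge0.
have v_ub t : 0 < t -> t < t1 -> ubound (ball_image v t) (phi t).
  move=> t0 tt1 _ [x /= xt <-]; rewrite vE; last exact: le_lt_trans tt1.
  exact: phi_mono.
have v_sup t : 0 < t -> t < t1 -> has_sup (ball_image v t).
  move=> t0 tt1; split; last by exists (phi t); exact: v_ub.
  by exists (v 0), 0 => //=; rewrite enorm0 ltW.
have vnorm : hnorm delta (star_germ (E := E) hg) =
    hsup (star_fun (a := Ind) (b := Pow Ind) (ball_image v) isT delta).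
  by apply: hnormE => xi; exact: habs_star_fun.
have v_gt0 t : 0 < t -> t < t1 -> 0 < sup (ball_image v t).
  (* Rescaling [z] gives a point of norm exactly [t], which the closed ball contains and where [v]
     equals [phi t]. *)
  move=> t0 tt1; pose x := (t / enorm z) *: z.
  have xt : enorm x = t.
    rewrite enormZ ger0_norm ?divr_ge0 ?(ltW t0) ?enorm_ge0//.
    by rewrite divfK// gt_eqF// enorm_gt0.
  apply: (@lt_le_trans _ _ (v x)); first by rewrite vE xt// phi_gt0.
  by apply: ub_le_sup; [have [] := v_sup t t0 tt1|exists x => //=; rewrite xt].
(* Convergence is tested at the norm of [hg]; its positivity is transferred from [v_gt0]. *)
have [|d0 cvg_d0] := f_cvg (hnorm delta (star_germ (E := E) hg)) (ex_intro2 _ _ hg I erefl).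
  rewrite vnorm (hsup_ball_image delta_inf t10 v_sup) /=.
  have := star_infinitesimal delta_inf t10 v_gt0.
  by move=> /(star_lt_cst (fun=> 0)); rewrite (star_fun_cst (b := Ind)).
have [_ le_refl _ _] := dirD.
(* A single continuous germ this close to [g] is already contradictory; reflexivity provides
   [f d0]. *)
have := cvg_d0 d0 (le_refl d0); rewrite vnorm.
have [t2 t20 fcont] := (continuous_germP (f d0)).1 (f_cont d0).
pose u x := `|sval (repr (f d0)) x - sval (repr g) x|.
rewrite (@hnormE _ _ _ _ u); last first.
  by move=> xi; rewrite /star_germ hsub_star_fun habs_star_fun.
have t120 : 0 < Num.min t1 t2 by rewrite lt_min t10.
apply: (hsup_ball_image_nlt delta_inf t120) => t t0; rewrite lt_min => /andP[tt1 tt2].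
  exact: v_sup.
move=> [_ u_ub].
(* [phi t] separates the suprema: it bounds [v] on the closed ball, and [phi_le] with the supremum
   of [u] as its constant puts it below that supremum. *)
apply: (@le_trans _ _ (phi t)).
  by apply: ge_sup; [have [] := v_sup t t0 tt1|exact: v_ub].
apply: (phi_le (sval (repr (f d0))) t) => // x xt.
  by apply: fcont; exact: lt_trans tt2.
by apply: ub_le_sup => //; exists x => //=; exact: ltW.
Qed.
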